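(* The map $z \mapsto a_z$ (the extension to 2-adic integer indices, described in the context, of the sequence given by $a_1=1$, $a_{2n}=a_n+1$, $a_{2n+1}=1/a_{2n}$ for $n\ge 1$) gives a one-to-one correspondence between the 2-adic integers and the positive real numbers.
   Context: The sequence $(a_n)_{n\ge 1}$ of positive rational numbers is defined by $a_1=1$ and, for $n\ge 1$, $a_{2n}=a_n+1$ and $a_{2n+1}=1/a_{2n}$. A 2-adic integer is of the form $z=\sum 2^{m_i}$, where $(m_i)$ is an increasing finite or infinite sequence of nonnegative integers; infinite sums are taken as limits in the 2-adic norm, given on integers by $|2^k m|_2=1/2^k$ for $m$ odd. In other words, 2-adic integers are given by base two numerals that may extend infinitely to the left. Setting $n_0=m_0$ and $n_i=m_i-m_{i-1}$ for $i>0$, such a sum is written either as (i) $z=\sum_{m=0}^{k}2^{n_0+n_1+\cdots+n_m}$ for some integer $k\ge 0$ (a positive integer), or (ii) $z=\sum_{m=0}^{\infty}2^{n_0+n_1+\cdots+n_m}$, where the $n_i$ are integers with $n_0\ge 0$ and $n_i>0$ for $i>0$. In case (i), $a_z$ is the term of the sequence above whose index is the positive integer $z$; it equals the finite continued fraction $n_0+\cfrac{1}{n_1+\cfrac{1}{\ddots+\cfrac{1}{n_{k-1}+\cfrac{1}{1+n_k}}}}$ (which is $1+n_0$ if $k=0$). In case (ii), $a_z$ is the value of the infinite continued fraction $$a_z=n_0+\cfrac{1}{n_1+\cfrac{1}{n_2+\cfrac{1}{n_3+\cdots}}},$$ that is, the limit as $m\to\infty$ of the finite continued fractions $n_0+\cfrac{1}{n_1+\cfrac{1}{\ddots+\cfrac{1}{n_m}}}$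 (this limit always exists). No separate value is specified for the index $z=0$.
   Formalization: The correspondence is stated for the nonzero 2-adic integers: no value a_0 is defined for z = 0, and since the nonzero 2-adic integers already correspond one-to-one to all positive reals, none could be assigned. *)

(* Defs.v *)
From Corelib Require Import BinNums.
From mathcomp Require Import all_boot all_order all_algebra.
From mathcomp Require Import all_classical all_reals all_analysis.

Set Implicit Arguments.
Unset Strict Implicit.
Unset Printing Implicit Defensive.

Import Order.TTheory GRing.Theory Num.Theory.
Import numFieldNormedType.Exports.

Local Open Scope classical_set_scope.
Local Open Scope ring_scope.

(* The recursion on [positive] is a_1 = 1, a_{2p} = a_p + 1 and
   a_{2p+1} = 1 / a_{2p}; see [a_seq1], [a_seq_even] and [a_seq_odd]. *)
Fixpoint a_pos (p : positive) : rat :=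
  match p with
  | xH => 1
  | xO p => a_pos p + 1
  | xI p => (a_pos p + 1)^-1
  end.

(* The sequence starts at index 1; the value at 0 is meaningless. *)
Definition a_seq (n : nat) : rat :=
  if bin_of_nat n is Npos p then a_pos p else 0.

Lemma a_seq1 : a_seq 1 = 1.
Proof. by []. Qed.

Lemma a_seq_pos (p : positive) : a_seq (nat_of_pos p) = a_pos p.
Proof. by have := nat_of_binK (Npos p) => /= E; rewrite /a_seq E. Qed.

Lemma nat_of_pos_ex (n : nat) : (0 < n)%N -> exists p, n = nat_of_pos p.
Proof.
move=> n0; have := bin_of_natK n; case: (bin_of_nat n) => [E|p E].
  by move: n0; rewrite -E.
by exists p; rewrite -E.
Qed.

Lemma a_seq_even (n : nat) : (0 < n)%N -> a_seq (2 * n) = a_seq n + 1.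
Proof.
move=> /nat_of_pos_ex[p ->].
rewrite mul2n; have -> : (nat_of_pos p).*2 = nat_of_pos (xO p) by rewrite /= natTrecE.
by rewrite !a_seq_pos.
Qed.

Lemma a_seq_odd (n : nat) : (0 < n)%N -> a_seq (2 * n).+1 = 1 / a_seq (2 * n).
Proof.
move=> /nat_of_pos_ex[p ->].
rewrite div1r mul2n.
have -> : (nat_of_pos p).*2.+1 = nat_of_pos (xI p) by rewrite /= natTrecE.
have -> : (nat_of_pos p).*2 = nat_of_pos (xO p) by rewrite /= natTrecE.
by rewrite !a_seq_pos.
Qed.

(* A 2-adic integer is a base two numeral that may extend infinitely to the
   left: [z i] is the digit of weight 2 ^ i. *)
Definition adic2 := nat -> bool.

Definition adic2_of_nat (N : nat) : adic2 := fun i => odd (N %/ 2 ^ i).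

(* |z - w|_2: the 2-adic valuation of a difference is the position of the first
   digit at which the two numerals differ; see [adic2_dist_nat]. *)
Definition adic2_dist (R : realType) (z w : adic2) : R :=
  match pselect (exists i, z i != w i) with
  | left h => 2 ^- ex_minn h
  | right _ => 0
  end.

Lemma adic2_dist_nat (R : realType) (N k m : nat) : odd m ->
  adic2_dist R (adic2_of_nat (N + 2 ^ k * m)) (adic2_of_nat N) = 2 ^- k.
Proof.
move=> om.
have lowE i : (i < k)%N ->
    adic2_of_nat (N + 2 ^ k * m) i = adic2_of_nat N i.
  move=> ik; rewrite /adic2_of_nat -(subnKC ik) addSn expnS expnD.
  rewrite mulnCA -!mulnA divnDr ?dvdn_mulr// mulKn ?expn_gt0//.
  by rewrite oddD oddM /= addbF.
have kN : adic2_of_nat (N + 2 ^ k * m) k != adic2_of_nat N k.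
  rewrite /adic2_of_nat divnDr ?dvdn_mulr// mulKn ?expn_gt0//.
  by rewrite oddD om addbT; case: odd.
rewrite /adic2_dist; case: pselect => [h|[]]; last by exists k.
case: ex_minnP => j jN jmin; congr (2 ^- _); apply/eqP.
rewrite eqn_leq (jmin _ kN) leqNgt; apply/negP => jk.
by move: jN; rewrite lowE// eqxx.
Qed.

(* \sum_(m <= k) 2 ^ (n_0 + n_1 + ... + n_m) *)
Definition partial_sum (n : nat -> nat) (k : nat) : nat :=
  (\sum_(m < k.+1) 2 ^ (\sum_(i < m.+1) n i))%N.

(* z is the 2-adic limit of the partial sums determined by n. *)
Definition is_infinite_sum (R : realType) (n : nat -> nat) (z : adic2) : Prop :=
  (fun k => adic2_dist R (adic2_of_nat (partial_sum n k)) z) @ \oo --> (0 : R).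

(* n_0 + 1 / (n_1 + 1 / (... + 1 / n_m)) *)
Fixpoint cfrac (R : realType) (n : nat -> nat) (m : nat) : R :=
  match m with
  | 0 => (n 0%N)%:R
  | m.+1 => (n 0%N)%:R + 1 / cfrac R (fun i => n i.+1) m
  end.

(* x is the value attached to z: the term of index N if z is a positive integer
   N, the value of an infinite continued fraction if z is an infinite sum.
   Nothing is attached to z = 0. *)
Definition is_a_value (R : realType) (z : adic2) (x : R) : Prop :=
  (exists N : nat, [/\ (0 < N)%N, z = adic2_of_nat N & x = ratr (a_seq N)]) \/
  (exists n : nat -> nat,
    [/\ forall i, (0 < i)%N -> (0 < n i)%N,
        is_infinite_sum R n z
      & cfrac R n m @[m --> \oo] --> x]).

Definition a_adic (R : realType) (z : adic2) : R :=
  xget 0 [set x | is_a_value z x].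

(* Main.v *)
Require Import Defs.
From mathcomp Require Import all_boot all_order all_algebra.
From mathcomp Require Import all_classical all_reals all_analysis.
From mathcomp Require Import zify ring lra.

Import Order.TTheory GRing.Theory Num.Theory.
Import numFieldNormedType.Exports.

Local Open Scope classical_set_scope.
Local Open Scope ring_scope.

(** Dropping the lowest binary digit of a nonzero index acts on values by a map
of the positive reals: if [y] is the value of the remaining numeral, the whole
numeral has value [1 + y] when the dropped digit is 0 and [1 / (1 + y)] when it
is 1, except that the numeral 1 has value 1 ([is_a_value_shift]).  The first
kind of value lies in ]1, +oo[, the second in ]0, 1[, and both maps are
injective, so a value determines all the digits of its index, one after the
other ([is_a_value_inj]).

An index with infinitely many digits 1 is described by the lengths
[p 0, p 1, ...] of the runs of zeros that precede these digits, lowest digits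
first.  They can be arbitrary, and the integers in the defining infinite sum
are [n_0 = p 0] and [n_i = p i + 1] for [i > 0].  The 2-adic limit
of the partial sums is the numeral with these runs ([is_infinite_sumE]), each
numeral with infinitely many digits 1 has exactly one sequence of runs
([numeral_surj], [numeral_inj]), and all other numerals are natural numbers
([adic2_caseP]).  In terms of runs the continued fraction is
[p 0 + 1 / (1 + (p 1 + 1 / (1 + ...)))], and since [u |-> 1 / (1 + u)] sends
nonnegative reals at distance at most [1 / (m + 1)] to reals at distance at most
[1 / (m + 2)], its [m]-th truncation is within [1 / (m + 1)] of any real with
the same partial quotients ([complete_quotients_approx]).  This gives both the
convergence ([cfrac_cvg]) and the surjectivity ([is_a_value_surj]): a positive
real that is not in the sequence [a_seq] keeps that property along its
continued fraction algorithm, so the algorithm does not stop, and its partial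
quotients are the runs of an index with the given value. *)

(** * Binary digits of natural numbers *)

Definition shift (z : adic2) : adic2 := fun i => z i.+1.

Lemma adic2_of_nat_shift (N : nat) :
  shift (adic2_of_nat N) = adic2_of_nat (N %/ 2).
Proof. by apply/funext => i; rewrite /shift /adic2_of_nat expnS divnMA. Qed.

Lemma adic2_of_nat_digit0 (N : nat) : adic2_of_nat N 0 = odd N.
Proof. by rewrite /adic2_of_nat divn1. Qed.

Lemma adic2_of_nat_double (b : bool) (N i : nat) :
  adic2_of_nat (b + 2 * N) i.+1 = adic2_of_nat N i.
Proof.
rewrite -[LHS]/(shift _ i) adic2_of_nat_shift; congr (adic2_of_nat _ i).
case: b; lia.
Qed.

Lemma adic2_of_nat0 (i : nat) : adic2_of_nat 0 i = false.
Proof. by rewrite /adic2_of_nat div0n. Qed.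

Lemma adic2_of_nat_inj : injective adic2_of_nat.
Proof.
move=> N M; have [b] := ubnP (N + M); elim: b N M => // b IH N M NMb NM.
have odd_eq : odd N = odd M by rewrite -!adic2_of_nat_digit0 NM.
have [|NM0] := posnP (N + M); first lia.
have : (N %/ 2 = M %/ 2)%N.
  by apply: IH; [lia | rewrite -!adic2_of_nat_shift NM].
lia.
Qed.

(** A crude bound, from [N < 2 ^ N], is enough to tell natural numbers from
numerals with infinitely many digits 1. *)
Lemma adic2_of_nat_high (N i : nat) : (N <= i)%N -> adic2_of_nat N i = false.
Proof.
move=> Ni; rewrite /adic2_of_nat divn_small//.
by rewrite (leq_ltn_trans Ni)// ltn_expl.
Qed.

Lemma adic2_of_nat_finite (b : nat) (z : adic2) :
  (forall i, (b <= i)%N -> z i = false) -> exists N, z = adic2_of_nat N.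
Proof.
elim: b z => [|b IH] z zb.
  by exists 0%N; apply/funext => i; rewrite zb// adic2_of_nat0.
have [N zN] : exists N, shift z = adic2_of_nat N.
  by apply: IH => i bi; apply: zb.
exists (z 0 + 2 * N)%N; apply/funext => -[|i].
  by rewrite adic2_of_nat_digit0 oddD oddM/= addbF oddb.
by rewrite adic2_of_nat_double -zN.
Qed.

(** * Numerals with infinitely many digits 1 *)

(** Two successive digits 1 separated by [p i] zeros are at distance [p i + 1],
whereas [p 0] zeros put the first digit 1 at position [p 0]. *)
Definition gaps (p : nat -> nat) (i : nat) : nat := (p i + (0 < i)%N)%N.

Lemma gaps_surj (n : nat -> nat) :
  (forall i, (0 < i)%N -> (0 < n i)%N) -> exists p, n = gaps p.
Proof.
move=> n0; exists (fun i => n i - (0 < i)%N)%N; apply/funext => -[|i].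
  by rewrite /gaps/= subn0 addn0.
by rewrite /gaps/= subnK// n0.
Qed.

(** The runs of the numeral without its lowest digit: a digit 0 shortens the
first run, a digit 1 is what ends an empty first run. *)
Definition shift_runs (p : nat -> nat) : nat -> nat :=
  if p 0%N is k.+1 then fun i => if i is 0%N then k else p i
  else fun i => p i.+1.

(** The digit at position [i] is 1 exactly when, the [i] lower digits being
dropped, the current run of zeros is exhausted. *)
Definition numeral (p : nat -> nat) : adic2 :=
  fun i => iter i shift_runs p 0%N == 0%N.

Lemma numeral_shift (p : nat -> nat) : shift (numeral p) = numeral (shift_runs p).
Proof. by apply/funext => i; rewrite /shift /numeral iterSr. Qed.

Lemma numeral_add (p : nat -> nat) (i j : nat) :
  numeral p (i + j)%N = numeral (iter i shift_runs p) j.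
Proof. by rewrite /numeral addnC iterD. Qed.

Lemma iter_shift_runs (p : nat -> nat) :
  iter (p 0%N).+1 shift_runs p = fun i => p i.+1.
Proof.
have [k] := ubnP (p 0%N); elim: k p => // k IH p pk.
case E : (p 0%N) => [|a]; first by rewrite /= /shift_runs E.
have Ep : shift_runs p = fun i => if i is 0%N then a else p i.
  by rewrite /shift_runs E.
have Ea : a.+1 = (shift_runs p 0%N).+1 by rewrite Ep.
by rewrite iterSr Ea IH ?Ep//; lia.
Qed.

Lemma numeral_first (p : nat -> nat) (i : nat) :
  (i <= p 0)%N -> numeral p i = (i == p 0%N).
Proof.
elim: i p => [|i IH] p ip; first by rewrite /numeral/= eq_sym.
rewrite -[LHS]/(shift _ i) numeral_shift.
have E : (shift_runs p 0%N).+1 = p 0%N by rewrite /shift_runs; case: (p 0%N) ip.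
by rewrite IH; [rewrite -E eqSS | rewrite -ltnS E].
Qed.

Lemma numeral_inj : injective numeral.
Proof.
have first_le p q : numeral p = numeral q -> (p 0 <= q 0)%N.
  move=> pq; rewrite leqNgt; apply/negP => qp.
  have := numeral_first p _ (ltnW qp).
  by rewrite pq numeral_first// eqxx ltn_eqF.
have tail p : (fun i => numeral p ((p 0).+1 + i)%N)
    = numeral (fun i => p i.+1).
  by apply/funext => i; rewrite numeral_add iter_shift_runs.
move=> p q pq; apply/funext => i; elim: i p q pq => [|i IH] p q pq.
  by apply/eqP; rewrite eqn_leq !first_le.
apply: (IH (fun i => p i.+1) (fun i => q i.+1)).
rewrite -!tail pq; suff -> : p 0%N = q 0%N by [].
by apply/eqP; rewrite eqn_leq !first_le.
Qed.

Lemma numeral_infinite (p : nat -> nat) (b : nat) :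
  exists2 i, (b <= i)%N & numeral p i.
Proof.
exists (b + iter b shift_runs p 0)%N; first exact: leq_addr.
by rewrite numeral_add numeral_first.
Qed.

Lemma numeral_neq_nat (p : nat -> nat) (N : nat) : numeral p <> adic2_of_nat N.
Proof.
move=> pN; have [i Ni] := numeral_infinite p N.
by rewrite pN adic2_of_nat_high.
Qed.

(** The runs are read off by jumping from one digit 1 to the next: [runs b] lists
those of the part of [z] starting at position [b].  Dropping a digit then amounts
to incrementing [b], so the digits of [numeral (runs 0)] are compared with those
of [z] by looking only at the first run of each [runs b]. *)
Lemma numeral_surj (z : adic2) :
  (forall b, exists i, (b <= i)%N && z i) -> exists p, z = numeral p.
Proof.
move=> zinf; pose next b := ex_minn (zinf b).
pose runs b j := (next (iter j (S \o next) b) - iter j (S \o next) b)%N.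
have next_ge b : (b <= next b)%N.
  by rewrite /next; case: ex_minnP => i /andP[].
have next_eq b : (next b == b) = z b.
  rewrite /next; case: ex_minnP => i /andP[bi zi] imin.
  apply/eqP/idP => [<-//|zb]; apply/eqP; rewrite eqn_leq bi andbT.
  by apply: imin; rewrite leqnn.
have next_skip b : z b = false -> next b.+1 = next b.
  move=> zb; rewrite /next; case: ex_minnP => i /andP[bi zi] imin.
  case: ex_minnP => j /andP[bj zj] jmin; apply/eqP; rewrite eqn_leq.
  rewrite jmin ?zi ?(ltnW bi)// andbT imin// zj andbT ltn_neqAle bj andbT.
  by apply/eqP => bj'; move: zj; rewrite -bj' zb.
have shift_runsE b : shift_runs (runs b) = runs b.+1.
  rewrite /shift_runs; case zb : (z b).
    have nb : next b = b by apply/eqP; rewrite next_eq.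
    have -> : runs b 0%N = 0%N by rewrite /runs/= nb subnn.
    by apply/funext => j; rewrite /runs iterSr /= nb.
  have nb : (b < next b)%N.
    by rewrite ltn_neqAle next_ge andbT eq_sym next_eq zb.
  have Eb : runs b 0%N = (next b - b.+1).+1 by rewrite /runs/=; lia.
  rewrite Eb; apply/funext => -[|j]; first by rewrite /runs/= next_skip.
  by rewrite /runs !iterSr/= next_skip.
exists (runs 0%N); apply/funext => i.
have -> : numeral (runs 0%N) i = (runs i 0%N == 0%N).
  suff E : iter i shift_runs (runs 0%N) = runs i by rewrite /numeral E.
  by elim: i => //= i ->.
by rewrite -next_eq /runs/= subn_eq0 eqn_leq next_ge andbT.
Qed.

(** * Infinite sums of powers of two *)

Lemma sum_gapsS (p : nat -> nat) (m : nat) :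
  (\sum_(i < m.+2) gaps p i
   = (p 0).+1 + \sum_(i < m.+1) gaps (fun i => p i.+1) i)%N.
Proof.
rewrite big_ord_recl [X in (_ + X)%N]big_ord_recl /= [in RHS]big_ord_recl.
by rewrite /gaps/= !(addn0, addn1, addSn, addnS, addnA).
Qed.

Lemma partial_sum_gaps0 (p : nat -> nat) : partial_sum (gaps p) 0 = (2 ^ p 0)%N.
Proof. by rewrite /partial_sum !big_ord_recl !big_ord0 /gaps/= !addn0. Qed.

Lemma partial_sum_gapsS (p : nat -> nat) (k : nat) :
  partial_sum (gaps p) k.+1
  = (2 ^ p 0 * (1 + 2 * partial_sum (gaps (fun i => p i.+1)) k))%N.
Proof.
rewrite /partial_sum big_ord_recl mulnDr; congr addn.
  by rewrite big_ord_recl big_ord0 /gaps/= !addn0 muln1.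
rewrite mulnA -expnSr big_distrr/=; apply: eq_bigr => m _.
by rewrite -expnD -sum_gapsS.
Qed.

(** Dropping a digit 0 halves the partial sum without changing its number of
terms; dropping a digit 1 also consumes the term 1 of the sum.  At most [i] terms
are consumed on the way to the digit at position [i], and one is needed to
produce it, whence the bound on [k]. *)
Lemma partial_sum_digit (p : nat -> nat) (i k : nat) : (i <= k)%N ->
  adic2_of_nat (partial_sum (gaps p) k) i = numeral p i.
Proof.
have even_step q m : (0 < q 0)%N -> partial_sum (gaps q) m =
    (false + 2 * partial_sum (gaps (shift_runs q)) m)%N.
  rewrite /shift_runs; case E : (q 0%N) => [//|a] _.
  case: m => [|m]; first by rewrite !partial_sum_gaps0 E expnS.
  by rewrite !partial_sum_gapsS E expnS mulnA.
have odd_step q m : q 0%N = 0%N -> partial_sum (gaps q) m.+1 =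
    (true + 2 * partial_sum (gaps (shift_runs q)) m)%N.
  by move=> q0; rewrite partial_sum_gapsS /shift_runs q0 mul1n.
elim: i p k => [|i IH] p k ik.
  rewrite adic2_of_nat_digit0 /numeral/=; have [p0|p0] := posnP (p 0%N).
    by case: k ik => [|k] _; rewrite ?partial_sum_gaps0 ?odd_step ?p0//= oddM.
  by rewrite even_step// oddD oddM.
rewrite -[RHS]/(shift _ i) numeral_shift; have [p0|p0] := posnP (p 0%N).
  by case: k ik => // k ik; rewrite odd_step// adic2_of_nat_double IH.
by rewrite even_step// adic2_of_nat_double IH// ltnW.
Qed.

Lemma adic2_dist_ge0 (R : realType) (z w : adic2) : 0 <= adic2_dist R z w.
Proof. by rewrite /adic2_dist; case: pselect => // h; rewrite invr_ge0 exprn_ge0. Qed.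

Lemma adic2_dist_digit (R : realType) (z w : adic2) (i : nat) :
  adic2_dist R z w < 2 ^- i -> z i = w i.
Proof.
move=> zw; apply/eqP/negPn/negP => zwi; move: zw.
rewrite /adic2_dist; case: pselect => [h|[]]; last by exists i.
case: ex_minnP => j _ /(_ _ zwi) ji.
by apply/negP; rewrite -leNgt lef_pV2 ?posrE ?exprn_gt0// ler_weXn2l// ler1n.
Qed.

Lemma adic2_dist_le (R : realType) (z w : adic2) (k : nat) :
  (forall i, (i <= k)%N -> z i = w i) -> adic2_dist R z w <= 2 ^- k.
Proof.
move=> zw; rewrite /adic2_dist; case: pselect => [h|_]; last first.
  by rewrite invr_ge0 exprn_ge0.
case: ex_minnP => j zwj _.
rewrite lef_pV2 ?posrE ?exprn_gt0// ler_weXn2l// ?ler1n//.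
by rewrite leqNgt; apply/negP => jk; move: zwj; rewrite zw ?eqxx// ltnW.
Qed.

(** Convergence for the 2-adic distance is stabilisation of each digit, and
[partial_sum_digit] computes the stable digits. *)
Lemma is_infinite_sumE (R : realType) (p : nat -> nat) (z : adic2) :
  is_infinite_sum R (gaps p) z <-> z = numeral p.
Proof.
split=> [zp|->].
  apply/funext => i.
  have lti : \forall k \near \oo,
      adic2_dist R (adic2_of_nat (partial_sum (gaps p) k)) z < 2 ^- i.
    by apply: (cvgr_lt _ zp); rewrite invr_gt0 exprn_gt0.
  near \oo => k.
  rewrite -(@partial_sum_digit p i k); last by near: k; exact: nbhs_infty_ge.
  by apply/esym/(@adic2_dist_digit R); near: k.
apply: (@squeeze_cvgr _ _ _ _ (fun=> 0) (fun k => 2^-1 ^+ k)).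
- near=> k; rewrite adic2_dist_ge0/= exprVn adic2_dist_le// => i.
  exact: partial_sum_digit.
- exact: cvg_cst.
- by apply: cvg_expr; rewrite ger0_norm ?invr_ge0// invf_lt1// ltr1n.
Unshelve. all: by end_near. Qed.

(** * Convergence of the continued fractions *)

(** The extra unit in each gap but the first moves in front of the tail, which
thus becomes again the continued fraction of a sequence of gaps. *)
Lemma cfrac_gapsS (R : realType) (p : nat -> nat) (m : nat) :
  cfrac R (gaps p) m.+1
  = (p 0%N)%:R + (1 + cfrac R (gaps (fun i => p i.+1)) m)^-1.
Proof.
rewrite /= {1}/gaps addn0 div1r; congr (_ + _^-1).
by case: m => [|m] /=; rewrite /gaps addn1 addn0 -natr1; ring.
Qed.

Lemma cfrac_gaps0 (R : realType) (p : nat -> nat) :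
  cfrac R (gaps p) 0 = (p 0%N)%:R.
Proof. by rewrite /= /gaps addn0. Qed.

Lemma cfrac_ge (R : realType) (p : nat -> nat) (m : nat) :
  (p 0%N)%:R <= cfrac R (gaps p) m.
Proof.
elim: m p => [|m IH] p; first by rewrite cfrac_gaps0.
rewrite cfrac_gapsS lerDl invr_ge0 addr_ge0//.
by rewrite (le_trans _ (IH _)).
Qed.

Lemma cfrac_ge0 (R : realType) (p : nat -> nat) (m : nat) :
  0 <= cfrac R (gaps p) m.
Proof. exact: le_trans (cfrac_ge _ _ _). Qed.

(** With [u <= v] and [d = v - u], the new distance is
[d / ((1 + u) * (1 + v)) <= d / (1 + d)], and [d / (1 + d)] increases with [d]
and is equal to [1 / (m + 2)] for [d = 1 / (m + 1)]. *)
Lemma inv1D_contract (R : realType) (u v : R) (m : nat) : 0 <= u -> 0 <= v ->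
  `|u - v| <= m.+1%:R^-1 -> `|(1 + u)^-1 - (1 + v)^-1| <= m.+2%:R^-1.
Proof.
wlog uv : u v / u <= v => [hw|].
  by case: (leP u v) => [|/ltW] h u0 v0;
    [|rewrite distrC [X in _ -> X <= _]distrC]; apply: hw.
move=> u0 v0; rewrite distrC ger0_norm ?subr_ge0// => duv.
have u1 : 0 < 1 + u by lra.
have v1 : 0 < 1 + v by lra.
rewrite ger0_norm; last by rewrite subr_ge0 lef_pV2 ?posrE//; lra.
have m1 : 0 < m.+1%:R :> R by [].
have {}duv : (v - u) * m.+1%:R <= 1 by rewrite -ler_pdivlMr// mul1r.
rewrite -[leRHS]mul1r ler_pdivlMr// -natr1.
have -> : (1 + u)^-1 - (1 + v)^-1 = (v - u) / ((1 + u) * (1 + v)).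
  by field; lra.
rewrite mulrAC ler_pdivrMr ?mulr_gt0// mul1r.
nra.
Qed.

(** The real [x 0] and the truncated fraction come from [x m] and [p m] by the
same [m] maps; [inv1D_contract] improves the initial bound 1 at each of them. *)
Lemma complete_quotients_approx (R : realType) (p : nat -> nat) (x : nat -> R)
    (m : nat) :
  (forall i, 0 <= x i) ->
  (forall i, (i < m)%N -> x i = (p i)%:R + (1 + x i.+1)^-1) ->
  `|x m - (p m)%:R| <= 1 -> `|x 0%N - cfrac R (gaps p) m| <= m.+1%:R^-1.
Proof.
elim: m p x => [|m IH] p x x0 xp xm; first by rewrite cfrac_gaps0 invr1.
rewrite cfrac_gapsS xp// addrAC opprD addrA subrr add0r addrC.
apply: inv1D_contract => //; first exact: cfrac_ge0.
by apply: (IH (fun i => p i.+1) (fun i => x i.+1)) => // i im; exact: xp.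
Qed.

Lemma cfrac_le (R : realType) (p : nat -> nat) (m : nat) :
  cfrac R (gaps p) m <= (p 0%N)%:R + 1.
Proof.
case: m => [|m]; first by rewrite cfrac_gaps0 lerDl.
rewrite cfrac_gapsS lerD2l invf_le1 ?lerDl ?cfrac_ge0//.
by rewrite ltr_wpDr ?cfrac_ge0.
Qed.

Lemma cfrac_cvg (R : realType) (p : nat -> nat) :
  exists x : R, cfrac R (gaps p) m @[m --> \oo] --> x.
Proof.
apply/cvg_ex/cauchy_cvgP/cauchy_exP => e e0.
have [m] := ltr_add_invr e0; rewrite add0r => me.
exists (cfrac R (gaps p) m).
suff : \forall M \near \oo,
  ball (cfrac R (gaps p) m) e (cfrac R (gaps p) M) by [].
near=> M.
have mM : (m <= M)%N by near: M; exact: nbhs_infty_ge.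
rewrite -ball_normE /= distrC (le_lt_trans _ me)//.
(* The truncation at M has the tails of the fraction as complete quotients. *)
pose x i := cfrac R (gaps (fun j => p (i + j)%N)) (M - i).
suff : `|x 0%N - cfrac R (gaps p) m| <= m.+1%:R^-1 by rewrite /x subn0.
apply: complete_quotients_approx => [i|i im|]; first exact: cfrac_ge0.
- rewrite /x (_ : M - i = (M - i.+1).+1)%N; last lia.
  rewrite cfrac_gapsS addn0; congr (_ + (1 + cfrac _ (gaps _) _)^-1).
  by apply/funext => j; rewrite addnS.
- rewrite /x; set q := fun j => _.
  have -> : p m = q 0%N by rewrite /q addn0.
  have := cfrac_ge R q (M - m); have := cfrac_le R q (M - m).
  by rewrite ler_norml; lra.
Unshelve. all: by end_near. Qed.

Lemma cfrac_lim_gt0 (R : realType) (p : nat -> nat) (x : R) :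
  cfrac R (gaps p) m @[m --> \oo] --> x -> 0 < x.
Proof.
move=> p_cvg.
have px : cfrac R (gaps p) m.+1 @[m --> \oo] --> x by rewrite cvg_shiftS.
apply: (@lt_le_trans _ _ (2 + (p 1%N)%:R)^-1).
  by rewrite invr_gt0 ltr_wpDr.
apply: (cvgr_to_ge px); near=> m; rewrite cfrac_gapsS ler_wpDl//.
have := cfrac_ge0 R (fun i => p i.+1) m; have := cfrac_le R (fun i => p i.+1) m.
move=> /= c1 c0.
by rewrite lef_pV2 ?posrE ?ltr_wpDr//; lra.
Unshelve. all: by end_near. Qed.

(** If the lowest digit is 0, the first run and the fraction decrease by one; if
it is 1, the first run is empty and the fraction is [1 / (1 + tail)]. *)
Lemma cfrac_shift_runs (R : realType) (p : nat -> nat) (y : R) : 0 <= y ->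
  cfrac R (gaps (shift_runs p)) m @[m --> \oo] --> y ->
  cfrac R (gaps p) m @[m --> \oo] -->
    (if p 0%N == 0%N then (1 + y)^-1 else 1 + y).
Proof.
move=> y0 py.
have p1y : 1 + cfrac R (gaps (shift_runs p)) m @[m --> \oo] --> 1 + y.
  by apply: cvgD => //; exact: cvg_cst.
case: ifPn => [/eqP p0|p0].
  rewrite -cvg_shiftS.
  rewrite (_ : (fun m => cfrac R (gaps p) m.+1)
      = fun m => (1 + cfrac R (gaps (shift_runs p)) m)^-1); last first.
    by apply/funext => m; rewrite cfrac_gapsS /shift_runs p0 add0r.
  by apply: cvgV => //; rewrite gt_eqF// ltr_wpDr.
rewrite (_ : cfrac R (gaps p)
    = fun m => 1 + cfrac R (gaps (shift_runs p)) m)//.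
apply/funext; rewrite /shift_runs; case pk : (p 0%N) p0 => [//|k] _.
case=> [|m]; first by rewrite !cfrac_gaps0 pk -natr1 addrC.
by rewrite !cfrac_gapsS pk -natr1 addrA [1 + k%:R]addrC.
Qed.

(** * Values of 2-adic indices *)

Lemma a_seq_halve (N : nat) : (1 < N)%N ->
  a_seq N = if odd N then (1 + a_seq (N %/ 2))^-1 else 1 + a_seq (N %/ 2).
Proof.
move=> N1; have M0 : (0 < N %/ 2)%N by lia.
have NM : N = (odd N + 2 * (N %/ 2))%N by lia.
rewrite {1}NM; case: odd; rewrite ?add1n ?add0n.
  by rewrite a_seq_odd// a_seq_even// div1r addrC.
by rewrite a_seq_even// addrC.
Qed.

Lemma a_seq_gt0 (N : nat) : (0 < N)%N -> 0 < a_seq N.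
Proof.
elim/ltn_ind: N => N IH N0; have [N1|N1] := leqP N 1.
  by have -> : N = 1%N by lia.
have M0 : 0 < a_seq (N %/ 2) by apply: IH; lia.
by rewrite a_seq_halve//; case: ifP => _; rewrite ?invr_gt0 ltr_wpDl.
Qed.

Lemma is_a_value_nat (R : realType) (N : nat) (x : R) : (0 < N)%N ->
  is_a_value (adic2_of_nat N) x <-> x = ratr (a_seq N).
Proof.
move=> N0; split=> [[[M [M0 /adic2_of_nat_inj <-]]//|[n [n0]]]|->].
  have [p ->] := gaps_surj _ n0 => /is_infinite_sumE Np.
  by case: (numeral_neq_nat p N).
by left; exists N.
Qed.

Lemma is_a_value_numeral (R : realType) (p : nat -> nat) (x : R) :
  is_a_value (numeral p) x <-> cfrac R (gaps p) m @[m --> \oo] --> x.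
Proof.
split=> [[[N [_ /numeral_neq_nat//]]|[n [n0]]]|px].
  have [q ->] := gaps_surj _ n0 => /is_infinite_sumE /numeral_inj <-.
  by [].
right; exists (gaps p); split=> // [i i0|]; last exact/is_infinite_sumE.
by rewrite /gaps i0 addn1.
Qed.

Lemma adic2_caseP (z : adic2) : z <> adic2_of_nat 0 ->
  (exists2 N, (0 < N)%N & z = adic2_of_nat N) \/ (exists p, z = numeral p).
Proof.
move=> z0; have [[b zb]|zinf] :=
  pselect (exists b, forall i, (b <= i)%N -> z i = false).
  have [N zN] := adic2_of_nat_finite _ _ zb; left; exists N => //.
  by rewrite lt0n; apply/eqP => N0; apply: z0; rewrite zN N0.
right; apply: numeral_surj => b; apply: contrapT => nb; apply: zinf.
exists b => i bi; apply/negbTE/negP => zi; apply: nb.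
by exists i; rewrite bi.
Qed.

Lemma is_a_value_neq0 (R : realType) (z : adic2) (x : R) :
  is_a_value z x -> z <> adic2_of_nat 0.
Proof.
case=> [[N [N0 -> _]] /adic2_of_nat_inj E|[n [n0 nz _]] z0].
  by rewrite E in N0.
move: nz; have [p ->] := gaps_surj _ n0 => /is_infinite_sumE pz.
by apply: (numeral_neq_nat p 0); rewrite -pz.
Qed.

Lemma is_a_value_exists (R : realType) (z : adic2) :
  z <> adic2_of_nat 0 -> exists x : R, is_a_value z x.
Proof.
move=> /adic2_caseP[[N N0 ->]|[p ->]].
  by exists (ratr (a_seq N)); apply/is_a_value_nat.
by have [x px] := cfrac_cvg R p; exists x; apply/is_a_value_numeral.
Qed.

Lemma is_a_value_unique (R : realType) (z : adic2) (x y : R) :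
  is_a_value z x -> is_a_value z y -> x = y.
Proof.
move=> zx; have /adic2_caseP[[N N0 zN]|[p zp]] := is_a_value_neq0 _ _ _ zx.
  by move: zx; rewrite zN => /is_a_value_nat -> // /is_a_value_nat ->.
move: zx; rewrite zp => /is_a_value_numeral px /is_a_value_numeral py.
exact: (norm_cvg_unique px py).
Qed.

Lemma is_a_value_gt0 (R : realType) (z : adic2) (x : R) :
  is_a_value z x -> 0 < x.
Proof.
move=> zx; have /adic2_caseP[[N N0 zN]|[p zp]] := is_a_value_neq0 _ _ _ zx.
  by move: zx; rewrite zN => /is_a_value_nat -> //; rewrite ltr0q a_seq_gt0.
by move: zx; rewrite zp => /is_a_value_numeral; exact: cfrac_lim_gt0.
Qed.

Lemma is_a_value_shift (R : realType) (z : adic2) (x : R) :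
  is_a_value z x ->
  (z = adic2_of_nat 1 /\ x = 1) \/
  (exists2 y, is_a_value (shift z) y & x = if z 0%N then (1 + y)^-1 else 1 + y).
Proof.
move=> zx; have /adic2_caseP[[N N0 zN]|[p zp]] := is_a_value_neq0 _ _ _ zx.
  move: zx; rewrite zN => /is_a_value_nat ->//.
  have [N1|N1] := leqP N 1.
    have -> : N = 1%N by lia.
    by left; rewrite a_seq1 rmorph1.
  right; exists (ratr (a_seq (N %/ 2))).
    by rewrite adic2_of_nat_shift; apply/is_a_value_nat => //; lia.
  rewrite adic2_of_nat_digit0 a_seq_halve//.
  by case: ifP => _; rewrite ?fmorphV rmorphD rmorph1.
have [y py] := cfrac_cvg R (shift_runs p).
have y0 := cfrac_lim_gt0 _ _ _ py.
right; exists y; first by rewrite zp numeral_shift; apply/is_a_value_numeral.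
move: zx; rewrite zp => /is_a_value_numeral px.
exact: (norm_cvg_unique px (cfrac_shift_runs _ _ _ (ltW y0) py)).
Qed.

(** The value tells which step produced it: it is equal to 1 for the numeral 1,
less than 1 after a digit 1 and greater than 1 after a digit 0.  Hence equal
values force equal lowest digits and, the two maps being injective, equal values
of the remaining numerals; every digit is then reached by induction. *)
Lemma is_a_value_inj (R : realType) (z w : adic2) (x : R) :
  is_a_value z x -> is_a_value w x -> z = w.
Proof.
have digit_lt1 (b : bool) (y : R) : 0 < y ->
    ((if b then (1 + y)^-1 else 1 + y) < 1) = b.
  case: b => y0; first by rewrite invf_lt1 ?ltrDl// ltr_wpDl.
  by apply/negbTE; rewrite -leNgt lerDl ltW.
have digit_neq1 (b : bool) (y : R) : 0 < y ->
    1 <> if b then (1 + y)^-1 else 1 + y.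
  move=> y0 E; have := digit_lt1 b y y0; rewrite -E ltxx => b0.
  by move: E; rewrite -b0; lra.
have step (u v : adic2) (t : R) : is_a_value u t -> is_a_value v t ->
    u = v \/ (u 0%N = v 0%N /\
               exists y : R, is_a_value (shift u) y /\ is_a_value (shift v) y).
  move=> /is_a_value_shift[[-> ->]|[y uy ->]]
    /is_a_value_shift[[-> t1]|[y' vy' t1]]; first by left.
  - by case: (digit_neq1 (v 0%N) y' (is_a_value_gt0 _ _ _ vy')).
  - by case: (digit_neq1 (u 0%N) y (is_a_value_gt0 _ _ _ uy)).
  have uv : u 0%N = v 0%N.
    rewrite -(digit_lt1 (u 0%N) _ (is_a_value_gt0 _ _ _ uy)) t1.
    by rewrite digit_lt1//; exact: is_a_value_gt0 vy'.
  right; split=> //; exists y; split=> //; suff -> : y = y' by [].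
  by move: t1; rewrite uv; case: (v 0%N) => [/invr_inj|] /addrI.
move=> zx wx; apply/funext => i; elim: i z w x zx wx => [|i IH] z w x zx wx.
  by have [->|[]] := step _ _ _ zx wx.
have [->//|[_ [y [zy wy]]]] := step _ _ _ zx wx.
exact: (IH (shift z) (shift w) y).
Qed.

(** The set of values of natural numbers contains 1 and is stable under
[t |-> 1 + t] and [t |-> 1 / (1 + t)], hence no complete quotient of a positive
real outside this set belongs to it; in particular none is an integer, and the
continued fraction algorithm goes on forever. *)
Lemma is_a_value_surj (R : realType) (x : R) : 0 < x ->
  exists z, is_a_value z x.
Proof.
pose finite_value (t : R) := exists2 N, (0 < N)%N & t = ratr (a_seq N).
have finite1D t : finite_value t -> finite_value (1 + t).
  move=> [N N0 ->]; exists (2 * N)%N; first by rewrite muln_gt0.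
  by rewrite a_seq_even// rmorphD rmorph1 addrC.
have finiteV t : finite_value t -> finite_value (1 + t)^-1.
  move=> [N N0 ->]; exists (2 * N).+1 => //.
  by rewrite a_seq_odd// a_seq_even// div1r fmorphV rmorphD rmorph1 addrC.
have finiteD k t : finite_value t -> finite_value (k%:R + t).
  by move=> ft; elim: k => [|k IH]; rewrite ?add0r// -natr1 addrAC addrC; auto.
have finite_nat k : (0 < k)%N -> finite_value k%:R.
  case: k => // k _; rewrite -natr1; apply: finiteD.
  by exists 1%N; rewrite // a_seq1 rmorph1.
pose infinite_value (t : R) := 0 < t /\ ~ finite_value t.
(* The next complete quotient, reduced by one as the runs are. *)
pose residue (t : R) : R := (t - (Num.trunc t)%:R)^-1 - 1.
have residueE t : infinite_value t ->
    infinite_value (residue t) /\ t = (Num.trunc t)%:R + (1 + residue t)^-1.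
  move=> [t0 nft]; have /andP[tge tlt] := trunc_itv (ltW t0).
  have tn0 : 0 < t - (Num.trunc t)%:R.
    rewrite subr_gt0 lt_neqAle tge andbT; apply/eqP => tE.
    apply: nft; rewrite -tE; apply: finite_nat.
    by rewrite -(ltr0n R) tE.
  have tE : t = (Num.trunc t)%:R + (1 + residue t)^-1.
    by rewrite /residue [1 + _]addrC subrK invrK addrC subrK.
  split=> //; split; last first.
    by move=> /finiteV /(finiteD (Num.trunc t)); rewrite -tE.
  by rewrite /residue subr_gt0 invf_gt1// ltrBlDl natr1.
move=> x0; have [[N N0 ->]|nfx] := pselect (finite_value x).
  by exists (adic2_of_nat N); apply/is_a_value_nat.
pose y i := iter i residue x; pose p i := Num.trunc (y i).
have yinf i : infinite_value (y i).
  by elim: i => //= i /residueE[].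
have y0 i : 0 <= y i by have [/ltW] := yinf i.
exists (numeral p); apply/is_a_value_numeral/cvgrPdist_le => e e0.
have [M] := ltr_add_invr e0; rewrite add0r => Me.
near=> m; apply: (@le_trans _ _ m.+1%:R^-1).
  apply: (complete_quotients_approx R p y) => // [i _|].
    by have [_] := residueE _ (yinf i).
  by have /andP[] := trunc_itv (y0 m); rewrite -natr1 ler_norml /p; lra.
apply: le_trans (ltW Me); rewrite lef_pV2 ?posrE// ler_nat ltnS.
by near: m; exact: nbhs_infty_ge.
Unshelve. all: by end_near. Qed.

Theorem mainTheorem1 (R : realType) :
  (forall z : adic2, z <> adic2_of_nat 0 ->
     forall x : R, is_a_value z x <-> x = a_adic R z) /\
  set_bij [set z : adic2 | z <> adic2_of_nat 0] [set x : R | 0 < x] (a_adic R).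
Proof.
have valueE z : z <> adic2_of_nat 0 ->
    forall x : R, is_a_value z x <-> x = a_adic R z.
  move=> z0 x; have za : is_a_value z (a_adic R z).
    exact: (xgetPex 0 (is_a_value_exists R _ z0)).
  by split=> [zx|->//]; exact: is_a_value_unique za.
split=> //; split.
- by move=> z /= z0; apply: (is_a_value_gt0 _ z); apply/valueE.
- move=> z w; rewrite !inE/= => z0 w0 zw.
  by apply: (is_a_value_inj R _ _ (a_adic R z)); apply/valueE.
- move=> x /= x0; have [z zx] := is_a_value_surj _ _ x0.
  have z0 := is_a_value_neq0 _ _ _ zx.
  by exists z => //; apply/esym/valueE.
Qed.
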